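(* Let $N>1$. The boundary (in $\mathbb{H}$) of the connected fundamental domain $\bigcup_{\gamma\in\Theta}\gamma\overline{D}$ for $\Gamma_0(N)$ has the following arcs (i.e. these are the arcs constituting the boundary), where $i,j$ range over $A=\{-N_1,\dots,N_2\}$: 1. $ST^{N_2}L$ and $ST^{-N_1}R$; 2. for each $i$ with $\gcd(i,N)=1$, the arc $ST^iB$; 3. for each $j$ with $\gcd(j,N)>1$: (a) $ST^jSR$, (b) $ST^jST^{M_j}L$, (c) $ST^jST^mB$ with $1\le m\le M_j$.
   Context: $\mathbb{H}$ is the upper half plane, with $\Gamma(1)=SL_2(\mathbb{Z})$ acting by Möbius transformations, $S=\begin{pmatrix}0&-1\\1&0\end{pmatrix}$, $T=\begin{pmatrix}1&1\\0&1\end{pmatrix}$. Put $N_1=\lfloor (N-1)/2\rfloor$, $N_2=\lfloor N/2\rfloor$, and $A=\{-N_1,\dots,N_2\}$, a set of consecutive integers representing $\mathbb{Z}/N$. With $\mathbb{N}=\mathbb{Z}_{>0}$ define, for $j\in\mathbb{Z}/N$ (and for an integer $j$ via its class), $$W_j=\min\{m\in\mathbb{N}\mid mj-1\in(\mathbb{Z}/N)^*\},\qquad M_j=W_j-1.$$ By convention $\gcd(0,N)=N$. The set $$\Theta=\{ST^i\mid i\in A\}\cup\{ST^jST^m\mid j\in A,\ \gcd(j,N)>1,\ 0\le m\le M_j\}$$ is (known to be) a set of right coset representatives for $\Gamma_0(N)\backslash\Gamma(1)$, and $\bigcup_{\gamma\in\Theta}\gamma\overline{D}$ is a connected fundamental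 domain for $\Gamma_0(N)$, where $D=\{z\in\mathbb{H}\mid |z|>1,\ |\operatorname{Re}z|<1/2\}$ and $\overline{D}$ is its closure in $\mathbb{H}$. The edges of $\overline D$ are $$L=\{z\in\mathbb{H}\mid\operatorname{Re}z=1/2,\ |z|\ge1\},\quad R=\{z\in\mathbb{H}\mid\operatorname{Re}z=-1/2,\ |z|\ge1\},\quad B=\{z\in\mathbb{H}\mid|z|=1,\ |\operatorname{Re}z|\le1/2\}.$$ *)

(* Defs.v *)
From HB Require Import structures.
From mathcomp Require Import all_boot all_order all_algebra.
From mathcomp Require Import all_classical all_reals all_analysis.
From mathcomp Require Import complex.

Set Implicit Arguments.
Unset Strict Implicit.
Unset Printing Implicit Defensive.

Import Order.TTheory GRing.Theory Num.Theory.
Import numFieldNormedType.Exports.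

Local Open Scope classical_set_scope.
Local Open Scope ring_scope.

Definition matrix2 (a b c d : int) : 'M[int]_2 :=
  \matrix_(i, j) nth 0 (nth [::] [:: [:: a; b]; [:: c; d]] i) j.

Definition matS : 'M[int]_2 := matrix2 0 (-1) 1 0.

Definition matT : 'M[int]_2 := matrix2 1 1 0 1.

Section Combinatorics.
Variable N : nat.

Definition N1 : nat := N.-1./2.
Definition N2 : nat := N./2.

Definition A : set int := [set i | - N1%:Z <= i <= N2%:Z].

(* ['Z_N] is Z/N only for [1 < N]. *)
Lemma W_exists (j : 'Z_N) :
  exists m : nat, (0 < m)%N && (m%:R * j - 1 \is a GRing.unit).
Proof.
exists (Zp_trunc N).+2; rewrite /=.
have -> : ((Zp_trunc N).+2%:R : 'Z_N) = 0.
  by apply: val_inj; rewrite Zp_nat /= modnn.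
by rewrite mul0r sub0r unitrN unitr1.
Qed.

Definition W (j : 'Z_N) : nat := ex_minn (W_exists j).

Definition M (j : int) : nat := (W j%:~R).-1.

Definition Theta : set 'M[int]_2 :=
  [set matS * matT ^ i | i in A] `|`
  [set g | exists (j : int) (m : nat),
     [/\ A j, 1 < gcdz j N, (m <= M j)%N &
         g = matS * matT ^ j * (matS * matT ^+ m)]].

End Combinatorics.

Section UpperHalfPlane.
Variable R : realType.
Local Notation C := R[i].

Definition upper_half_plane : set C := [set z | 0 < complex.Im z].

Definition moebius (g : 'M[int]_2) (z : C) : C :=
  ((g 0 0)%:~R * z + (g 0 1)%:~R) / ((g 1 0)%:~R * z + (g 1 1)%:~R).

(* Closure and boundary in the subspace topology of the half plane; the alias
   [R[i]^o] carries the norm topology of [R[i]]. *)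
Definition closureH (X : set C) : set C :=
  upper_half_plane `&` closure (X : set R[i]^o).

Definition boundaryH (X : set C) : set C :=
  closureH X `&` closureH (upper_half_plane `\` X).

Definition D : set C :=
  upper_half_plane `&` [set z | 1 < `|z| /\ `|complex.Re z| < 1 / 2].

Definition edgeL : set C :=
  upper_half_plane `&` [set z | complex.Re z = 1 / 2 /\ 1 <= `|z|].

Definition edgeR : set C :=
  upper_half_plane `&` [set z | complex.Re z = - (1 / 2) /\ 1 <= `|z|].

Definition edgeB : set C :=
  upper_half_plane `&` [set z | `|z| = 1 /\ `|complex.Re z| <= 1 / 2].

Variable N : nat.

Definition fundamental_domain : set C :=
  \bigcup_(g in Theta N) (moebius g @` closureH D).

(* Edges of the tiles of the fundamental domain that lie on its boundary. *)
Definition boundary_edges : set (set C) :=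
  [set X | exists (g : 'M[int]_2) (e : set C),
     [/\ Theta N g, e = edgeL \/ e = edgeR \/ e = edgeB,
         X = moebius g @` e &
         X `<=` boundaryH fundamental_domain]].

Inductive listed_arc : set C -> Prop :=
| arc1L : listed_arc (moebius (matS * matT ^ (N2 N)%:Z) @` edgeL)
| arc1R : listed_arc (moebius (matS * matT ^ (- (N1 N)%:Z)) @` edgeR)
| arc2 (i : int) : A N i -> gcdz i N = 1 ->
    listed_arc (moebius (matS * matT ^ i) @` edgeB)
| arc3a (j : int) : A N j -> 1 < gcdz j N ->
    listed_arc (moebius (matS * matT ^ j * matS) @` edgeR)
| arc3b (j : int) : A N j -> 1 < gcdz j N ->
    listed_arc
      (moebius (matS * matT ^ j * (matS * matT ^+ M N j)) @` edgeL)
| arc3c (j : int) (m : nat) : A N j -> 1 < gcdz j N ->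
    (1 <= m <= M N j)%N ->
    listed_arc (moebius (matS * matT ^ j * (matS * matT ^+ m)) @` edgeB).

End UpperHalfPlane.

Arguments fundamental_domain R N : clear implicits.
Arguments boundary_edges R N : clear implicits.
Arguments listed_arc R N : clear implicits.

(* Main.v *)
(* Among the tiles g D with g in Theta, whether the neighbour g T, g T^-1 or g S
   of g across an edge is again in Theta up to sign is read off from
   S T^i = (0, -1; 1, i) and S T^j S T^m = (-1, -m; j, j m - 1): the listed arcs
   are exactly the edges whose outer neighbour is missing.  A missing neighbour
   meets the domain only along its boundary, because z in D and g z in the
   closure of D force g = 1 or -1: otherwise |c z + d| > 1 and |- c g z + a| >= 1,
   while their product is 1.  Hence such an edge is in the boundary.
   Conversely, a point of the domain none of whose edges is listed is interior:
   at an inner point of an edge the two tiles cover a neighbourhood, and at a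
   vertex one crosses edges of the domain successively until all six tiles
   around the vertex are reached. *)

Require Import Defs.
From mathcomp Require Import all_boot all_order all_algebra.
From mathcomp Require Import all_classical all_reals all_analysis.
From mathcomp Require Import finmap complex ring lra zify.
Set Implicit Arguments.
Unset Strict Implicit.
Unset Printing Implicit Defensive.
Import Order.TTheory GRing.Theory Num.Theory.
Import numFieldNormedType.Exports.
Local Open Scope classical_set_scope.
Local Open Scope ring_scope.

(** * Integer 2 by 2 matrices of determinant 1 *)

Lemma mul_matrix2 (a b c d a' b' c' d' : int) :
  matrix2 a b c d * matrix2 a' b' c' d' =
  matrix2 (a * a' + b * c') (a * b' + b * d')
          (c * a' + d * c') (c * b' + d * d').
Proof.
apply/matrixP => i j; rewrite !mxE !big_ord_recl big_ord0 addr0 !mxE.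
by case: i => [[|[|//]] ?]; case: j => [[|[|//]] ?].
Qed.

Lemma opp_matrix2 (a b c d : int) :
  - matrix2 a b c d = matrix2 (- a) (- b) (- c) (- d).
Proof.
apply/matrixP => i j; rewrite !mxE.
by case: i => [[|[|//]] ?]; case: j => [[|[|//]] ?].
Qed.

Lemma matrix2_inj (a b c d a' b' c' d' : int) :
  matrix2 a b c d = matrix2 a' b' c' d' ->
  [/\ a = a', b = b', c = c' & d = d'].
Proof.
move=> /matrixP E.
by have := E 0 0; have := E 0 1; have := E 1 0; have := E 1 1; rewrite !mxE.
Qed.

Lemma matrix2_eta (g : 'M[int]_2) : g = matrix2 (g 0 0) (g 0 1) (g 1 0) (g 1 1).
Proof.
apply/matrixP => i j; rewrite !mxE.
case: i => [[|[|//]] ?]; case: j => [[|[|//]] ?];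
  by congr (g _ _); apply: val_inj.
Qed.

Lemma matrix2_1 : 1 = matrix2 1 0 0 1.
Proof. by rewrite [LHS]matrix2_eta !mxE. Qed.

Lemma matTXn (n : nat) : matT ^+ n = matrix2 1 n%:Z 0 1.
Proof.
elim: n => [|n IH]; first by rewrite expr0 matrix2_1.
by rewrite exprS IH mul_matrix2; congr matrix2; lia.
Qed.

Lemma matTXz (n : int) : matT ^ n = matrix2 1 n 0 1.
Proof.
case: n => n; first exact: matTXn.
(* The remaining exponent is [- n.+1]; the power is then a ring inverse, found by exhibiting a
   two-sided inverse of [matT ^+ n.+1]. *)
have E : matT ^+ n.+1 * matrix2 1 (- n.+1%:Z) 0 1 = 1.
  by rewrite matTXn mul_matrix2 matrix2_1; congr matrix2; lia.
have E' : matrix2 1 (- n.+1%:Z) 0 1 * matT ^+ n.+1 = 1.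
  by rewrite matTXn mul_matrix2 matrix2_1; congr matrix2; lia.
have U : matT ^+ n.+1 \is a GRing.unit by apply/unitrP; eexists; split; eassumption.
rewrite NegzE -invr_expz -[LHS]mulr1 -[X in _ * X]E mulKr //.
Qed.

(** The adjugate: the inverse of [g] in the determinant 1 case, with explicit entries. *)
Definition adj2 (g : 'M[int]_2) : 'M[int]_2 :=
  matrix2 (g 1 1) (- g 0 1) (- g 1 0) (g 0 0).

(** Amounts to determinant 1, since [g * adj2 g] is the determinant times the identity. *)
Definition in_SL2 (g : 'M[int]_2) : Prop := g * adj2 g = 1.

Lemma in_SL2_matrix2 (a b c d : int) :
  a * d - b * c = 1 -> in_SL2 (matrix2 a b c d).
Proof.
move=> E; rewrite /in_SL2 /adj2 !mxE /= mul_matrix2 matrix2_1.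
by congr matrix2; lia.
Qed.

Lemma in_SL2_det (g : 'M[int]_2) :
  in_SL2 g -> g 0 0 * g 1 1 - g 0 1 * g 1 0 = 1.
Proof.
rewrite /in_SL2 /adj2 [X in X * _]matrix2_eta mul_matrix2 matrix2_1.
by move=> /matrix2_inj[]; lia.
Qed.

Lemma in_SL2M (g h : 'M[int]_2) : in_SL2 g -> in_SL2 h -> in_SL2 (g * h).
Proof.
move=> /in_SL2_det Dg /in_SL2_det Dh.
rewrite [g]matrix2_eta [h]matrix2_eta mul_matrix2; apply: in_SL2_matrix2.
rewrite -[RHS]mulr1 -{1}Dg -Dh; ring.
Qed.

Lemma in_SL2_adj (g : 'M[int]_2) : in_SL2 g -> in_SL2 (adj2 g).
Proof. by move=> /in_SL2_det Dg; apply: in_SL2_matrix2; lia. Qed.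

Lemma adj2K (g : 'M[int]_2) : adj2 (adj2 g) = g.
Proof. by rewrite [RHS]matrix2_eta /adj2 !mxE /= !opprK. Qed.

Lemma mul_adj2 (g : 'M[int]_2) : in_SL2 g -> adj2 g * g = 1.
Proof. by move=> /in_SL2_adj; rewrite /in_SL2 adj2K. Qed.

Lemma adj2M (g h : 'M[int]_2) : adj2 (g * h) = adj2 h * adj2 g.
Proof.
rewrite [g]matrix2_eta [h]matrix2_eta mul_matrix2 /adj2 !mxE /= mul_matrix2.
by congr matrix2; ring.
Qed.

Definition matTV : 'M[int]_2 := matrix2 1 (-1) 0 1.

Lemma in_SL2_S : in_SL2 matS. Proof. exact: in_SL2_matrix2. Qed.
Lemma in_SL2_T : in_SL2 matT. Proof. exact: in_SL2_matrix2. Qed.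
Lemma in_SL2_TV : in_SL2 matTV. Proof. exact: in_SL2_matrix2. Qed.

Lemma adj2_1 : adj2 1 = 1.
Proof. by rewrite matrix2_1 /adj2 !mxE. Qed.

Lemma adj2_T : adj2 matT = matTV.
Proof. by rewrite /adj2 !mxE. Qed.

Lemma adj2_TV : adj2 matTV = matT.
Proof. by rewrite /adj2 !mxE. Qed.

Lemma adj2_S : adj2 matS = - matS.
Proof. by rewrite /adj2 !mxE /= opp_matrix2. Qed.

Lemma in_SL2_1 : in_SL2 1.
Proof. by rewrite matrix2_1; exact: in_SL2_matrix2. Qed.

(** * Coset representatives as explicit matrices, and their neighbours *)

Section Tiles.
Variable N : nat.

Definition level1 (i : int) : 'M[int]_2 := matrix2 0 (-1) 1 i.
(** Here [m] is an integer, so that the neighbour [level2 j (-1)] of [level2 j 0] can be named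
    too. *)
Definition level2 (j m : int) : 'M[int]_2 := matrix2 (-1) (- m) j (j * m - 1).

Lemma level1E i : matS * matT ^ i = level1 i.
Proof. by rewrite matTXz mul_matrix2; congr matrix2; lia. Qed.

Lemma level2E j (m : nat) :
  matS * matT ^ j * (matS * matT ^+ m) = level2 j m.
Proof.
by rewrite matTXz matTXn !mul_matrix2; congr matrix2; lia.
Qed.

Lemma ThetaP g : Theta N g <->
  (exists2 i, A N i & g = level1 i) \/
  (exists j (m : nat), [/\ A N j, 1 < gcdz j N, (m <= M N j)%N & g = level2 j m]).
Proof.
split=> [[[i Ai <-]|[j [m [Aj gj mM ->]]]]|[[i Ai ->]|[j [m [Aj gj mM ->]]]]].
- by left; exists i; rewrite ?level1E.
- by right; exists j, m; rewrite level2E.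
- by left; exists i; rewrite ?level1E.
- by right; exists j, m; rewrite level2E.
Qed.

(* [g] and [- g] have the same Moebius action. *)
Definition tile (g : 'M[int]_2) : Prop := Theta N g \/ Theta N (- g).

Lemma tileN (g : 'M[int]_2) : tile (- g) <-> tile g.
Proof. by rewrite /tile opprK; split=> -[]; [right|left|right|left]. Qed.

(** The top rows [(0, -1)] and [(-1, -m)] tell the two families apart, and no such row is the
    negative of another. *)
Lemma tile_level1 i : tile (level1 i) <-> A N i.
Proof.
split=> [|Ai]; last by left; apply/ThetaP; left; exists i.
case=> /ThetaP[[k Ak]|[j [m [Aj gj mM]]]]; rewrite ?opp_matrix2 => /matrix2_inj[].
- by move=> _ _ _ ->.
- by [].
- by [].
- by [].
Qed.

Lemma tile_level2 j m : tile (level2 j m) <->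
  [/\ A N j, 1 < gcdz j N & 0 <= m <= (M N j)%:Z].
Proof.
split=> [|[Aj gj /andP[m0 mM]]]; last first.
  case: m m0 mM => // m _ mM; left; apply/ThetaP; right; exists j, m; split=> //.
case=> /ThetaP[[k Ak]|[j' [m' [Aj gj mM]]]]; rewrite ?opp_matrix2 => /matrix2_inj[] //.
move=> _ Em Ej _; subst j'; split=> //; lia.
Qed.
End Tiles.

(* [side e s]: across its edge [g e], the tile of [g] borders that of [g * s]. *)
Inductive side (R : realType) : set R[i] -> 'M[int]_2 -> Prop :=
| side_L : side (@edgeL R) matT
| side_R : side (@edgeR R) matTV
| side_B : side (@edgeB R) matS.

Lemma gcdz_cases (i : int) (N : nat) : (1 < N)%N ->
  gcdz i N = 1 \/ 1 < gcdz i N.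
Proof.
move=> N1; have : gcdz i N != 0 by rewrite gcdz_eq0; lia.
have : 0 <= gcdz i N by [].
lia.
Qed.

Lemma A_bounds (N : nat) i : A N i <-> - (N1 N)%:Z <= i /\ i <= (N2 N)%:Z.
Proof. by split=> [/andP|/andP]. Qed.

(** Right multiplication by [matT] or [matTV] shifts [i] in [level1 i] and [m] in [level2 j m] by
    one, so a neighbour is missing exactly at the ends of the ranges. [matS] exchanges [level1 j]
    and [level2 j 0] up to sign, which leaves [B] listed when [gcdz i N = 1] or [m > 0]. *)
Lemma listed_arcP (R : realType) (N : nat) (X : set R[i]) : (1 < N)%N ->
  listed_arc R N X <->
  exists g e s, [/\ Theta N g, side e s, X = moebius g @` e & ~ tile N (g * s)].
Proof.
move=> lt1N.
have Al i : A N i -> Theta N (level1 i) by move=> Ai; apply/ThetaP; left; exists i.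
have Al2 j (m : nat) : A N j -> 1 < gcdz j N -> (m <= M N j)%N ->
    Theta N (level2 j m).
  by move=> *; apply/ThetaP; right; exists j, m.
have l1T i : level1 i * matT = level1 (i + 1).
  by rewrite mul_matrix2; congr matrix2; lia.
have l1TV i : level1 i * matTV = level1 (i - 1).
  by rewrite mul_matrix2; congr matrix2; lia.
have l1S i : level1 i * matS = level2 i 0.
  by rewrite mul_matrix2; congr matrix2; lia.
have l2T j m : level2 j m * matT = level2 j (m + 1).
  by rewrite mul_matrix2; congr matrix2; lia.
have l2TV j m : level2 j m * matTV = level2 j (m - 1).
  by rewrite mul_matrix2; congr matrix2; lia.
have l2S0 j : level2 j 0 * matS = - level1 j.
  by rewrite mul_matrix2 opp_matrix2; congr matrix2; lia.
(* The top row of the product is [(-m, 1)]; for [m > 0] it is not [(0, -1)] or [(-1, -m')] with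
   [m' >= 0], even up to sign. *)
have l2S j (m : nat) : (0 < m)%N -> ~ tile N (level2 j m * matS).
  move=> m0; rewrite mul_matrix2.
  by case=> /ThetaP[[k Ak]|[j' [m' [Aj gj mM]]]];
    rewrite ?opp_matrix2 => /matrix2_inj[]; lia.
have l20 j : matS * matT ^ j * matS = level2 j 0.
  by rewrite -(level2E j 0) expr0 mulr1.
split.
- have N20 : 0 <= N2 N :> int by [].
  have N10 : 0 <= N1 N :> int by [].
  case=> [||i Ai gi|j Aj gj|j Aj gj|j m Aj gj /andP[m1 mM]];
    rewrite ?level2E ?l20 ?level1E.
  + exists (level1 (N2 N)), (@edgeL R), matT; split=> //; [|exact: side_L|].
    * by apply: Al; apply/A_bounds; lia.
    * rewrite l1T => /tile_level1/A_bounds; lia.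
  + exists (level1 (- (N1 N)%:Z)), (@edgeR R), matTV; split=> //; [|exact: side_R|].
    * by apply: Al; apply/A_bounds; lia.
    * rewrite l1TV => /tile_level1/A_bounds; lia.
  + exists (level1 i), (@edgeB R), matS; split=> //; [exact: Al|exact: side_B|].
    rewrite l1S => /tile_level2[_]; lia.
  + exists (level2 j 0), (@edgeR R), matTV; split=> //; [|exact: side_R|].
      exact: (Al2 j 0%N).
    by rewrite l2TV => /tile_level2[_ _]; lia.
  + exists (level2 j (M N j)), (@edgeL R), matT; split=> //; [|exact: side_L|].
      exact: Al2.
    by rewrite l2T => /tile_level2[_ _]; lia.
  + exists (level2 j m), (@edgeB R), matS; split=> //; [|exact: side_B|].
      exact: Al2.
    exact: l2S.
- case=> g [e [s [/ThetaP Tg se ->]]].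
  case: Tg se => [[i Ai ->]|[j [m [Aj gj mM ->]]]] [].
  + rewrite l1T => nt.
    have -> : i = N2 N.
      apply: contra_notP nt => ne; apply/tile_level1/A_bounds.
      by move/A_bounds: Ai; lia.
    by rewrite -level1E; exact: arc1L.
  + rewrite l1TV => nt.
    have -> : i = - (N1 N)%:Z.
      apply: contra_notP nt => ne; apply/tile_level1/A_bounds.
      by move/A_bounds: Ai; lia.
    by rewrite -level1E; exact: arc1R.
  + rewrite l1S => nt; case: (gcdz_cases i lt1N) => gi.
      by rewrite -level1E; exact: arc2.
    by case: nt; apply/tile_level2; split.
  + rewrite l2T => nt.
    have -> : m = M N j.
      by apply: contra_notP nt => ne; apply/tile_level2; split=> //; lia.
    by rewrite -level2E; exact: arc3b.
  + rewrite l2TV => nt.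
    have -> : m = 0%N.
      by apply: contra_notP nt => ne; apply/tile_level2; split=> //; lia.
    by rewrite -l20; exact: arc3a.
  + case: m mM => [|m] mM nt.
      by case: nt; rewrite l2S0; apply/tileN/tile_level1.
    by rewrite -level2E; exact: arc3c.
Qed.

(** * The Moebius action on the half plane *)

Section Moebius.
Variable R : realType.
Local Notation C := R[i].
Local Notation H := (@upper_half_plane R).
Implicit Types (z w : C) (g h s : 'M[int]_2) (e : set C).

(** The squared modulus as an element of [R], polynomial in the coordinates, whereas the norm [|z|]
    is an element of [R[i]] involving a square root. *)
Definition normsq z : R := complex.Re z ^+ 2 + complex.Im z ^+ 2.

Lemma normE z : `|z| = (Num.sqrt (normsq z))%:C%C.
Proof. exact: normc_def. Qed.

Lemma normsq_ge0 z : 0 <= normsq z.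
Proof. by rewrite addr_ge0 ?sqr_ge0. Qed.

Lemma normsq_gt0 z : z != 0 -> 0 < normsq z.
Proof.
case: z => x y; rewrite eq_complex /= /normsq /= lt0r addr_ge0 ?sqr_ge0 // andbT.
by rewrite paddr_eq0 ?sqr_ge0 // !sqrf_eq0.
Qed.

Lemma le1_norm z : (1 <= `|z|) = (1 <= normsq z).
Proof. by rewrite normE lecR -[X in X <= _]sqrtr1 ler_sqrt // normsq_ge0. Qed.

Lemma lt1_norm z : (1 < `|z|) = (1 < normsq z).
Proof.
by rewrite normE ltcR -[X in X < _]sqrtr1 !ltNge ler_sqrt.
Qed.

Lemma eq1_norm z : `|z| = 1 <-> normsq z = 1.
Proof.
rewrite normE; split=> [/complexI E|->]; last by rewrite sqrtr1.
by rewrite -(sqr_sqrtr (normsq_ge0 z)) E expr1n.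
Qed.

Lemma denom_neq0 g z : in_SL2 g -> H z ->
  (g 1 0)%:~R * z + (g 1 1)%:~R != 0 :> C.
Proof.
move=> /in_SL2_det Dg; case: z => x y; rewrite /upper_half_plane /= => y0.
rewrite -!(rmorph_int (real_complex R)) eq_complex /= !mul0r subr0 !addr0.
apply/negP => /andP[A1]; rewrite mulf_eq0 (gt_eqF y0) orbF => A2.
move: A1; rewrite (eqP A2) mul0r add0r intr_eq0 => /eqP d0.
by move: A2 Dg; rewrite intr_eq0 d0 => /eqP ->; lia.
Qed.

(** With determinant 1, the imaginary part gets divided by [normsq] of the denominator. *)
Lemma moebius_H g z : in_SL2 g -> H z -> H (moebius g z).
Proof.
move=> Ug Hz; have := denom_neq0 Ug Hz; have /in_SL2_det Dg := Ug.
rewrite /moebius; case: z Hz => x y; rewrite /upper_half_plane /= => y0.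
rewrite -!(rmorph_int (real_complex R)) => /normsq_gt0; rewrite /normsq /=.
have {}Dg : (g 0 0)%:~R * (g 1 1)%:~R - (g 0 1)%:~R * (g 1 0)%:~R = 1 :> R.
  by rewrite -!intrM -intrB Dg.
move: Dg; move: (g 0 0)%:~R (g 0 1)%:~R (g 1 0)%:~R (g 1 1)%:~R.
move=> a b c d Dg; set n := _ ^+ 2 + _ ^+ 2 => n0.
set t := (X in 0 < X); suff -> : t = y / n by apply: divr_gt0.
rewrite -[y]mul1r -Dg /t.
by field; rewrite gt_eqF.
Qed.

Lemma moebiusM g h z : in_SL2 g -> in_SL2 h -> H z ->
  moebius (g * h) z = moebius g (moebius h z).
Proof.
move=> Ug Uh Hz; have nh := denom_neq0 Uh Hz.
have ngh := denom_neq0 (in_SL2M Ug Uh) Hz.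
have ng := denom_neq0 Ug (moebius_H Uh Hz).
have E := mul_matrix2 (g 0 0) (g 0 1) (g 1 0) (g 1 1)
                      (h 0 0) (h 0 1) (h 1 0) (h 1 1).
rewrite -!matrix2_eta in E.
move: ng nh ngh; rewrite /moebius {}E !mxE /= => ng nh ngh.
field; rewrite nh /=; apply: contra_neq ngh => {ng nh} ngh.
by rewrite -[RHS]ngh; ring.
Qed.

Lemma moebius1 z : moebius 1 z = z.
Proof. by rewrite /moebius matrix2_1 !mxE /=; field. Qed.

Lemma moebiusN g z : moebius (- g) z = moebius g z.
Proof. by rewrite /moebius !mxE !intrN !mulNr -!opprD invrN mulrNN. Qed.

Lemma moebius_S z : moebius matS z = - z^-1.
Proof. by rewrite /moebius !mxE /= mul0r add0r mul1r addr0 mulN1r. Qed.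

Lemma moebius_T z : moebius matT z = z + 1.
Proof. by rewrite /moebius !mxE /= mul1r mul0r add0r divr1. Qed.

Lemma moebius_TV z : moebius matTV z = z - 1.
Proof. by rewrite /moebius !mxE /= mul1r mul0r add0r divr1. Qed.

Lemma moebiusK g z : in_SL2 g -> H z -> moebius (adj2 g) (moebius g z) = z.
Proof.
move=> Ug Hz; rewrite -moebiusM ?mul_adj2 ?moebius1 //; exact: in_SL2_adj.
Qed.

Lemma moebiusVK g z : in_SL2 g -> H z -> moebius g (moebius (adj2 g) z) = z.
Proof.
move=> Ug Hz; rewrite -[in moebius g](adj2K g) moebiusK //; exact: in_SL2_adj.
Qed.

(** * The closed tile by explicit inequalities, and rigidity of the open one *)

Definition closedD : set C :=
  [set z | [/\ 0 < complex.Im z, 1 <= normsq z, - (1 / 2) <= complex.Re z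
             & complex.Re z <= 1 / 2]].

Lemma DP z : D z <->
  [/\ 0 < complex.Im z, 1 < normsq z, - (1 / 2) < complex.Re z
    & complex.Re z < 1 / 2].
Proof.
rewrite /D /= /upper_half_plane /= lt1_norm ltr_norml.
split=> [[y0 [n1 /andP[]]]|[y0 n1 x1 x2]]; split=> //; split=> //.
by rewrite x1.
Qed.

Lemma D_closedD z : D z -> closedD z.
Proof. by move=> /DP[y0 n1 x1 x2]; split; rewrite ?ltW. Qed.

Lemma normsqM z w : normsq (z * w) = normsq z * normsq w.
Proof. by case: z => x y; case: w => u v; rewrite /normsq /=; ring. Qed.

Lemma normsq_denom (c d : int) z :
  normsq (c%:~R * z + d%:~R) =
  c%:~R ^+ 2 * normsq z + 2 * (c * d)%:~R * complex.Re z + d%:~R ^+ 2.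
Proof.
by case: z => x y; rewrite -!(rmorph_int (real_complex R)) /normsq /= intrM; ring.
Qed.

(** As the real part is at most 1/2 in absolute value, the left-hand cross term [2 c d Re z] is at
    least [- |c d|], and the positive definite forms [c^2 + c d + d^2] and [c^2 - c d + d^2] are at
    least 1 on integers with [c != 0]. *)
Lemma denom_norm_bound (c d : int) z : c != 0 -> closedD z ->
  c%:~R ^+ 2 * (normsq z - 1) + 1 <= normsq (c%:~R * z + d%:~R).
Proof.
move=> c0 [_ _ x1 x2].
have P : 1 <= c ^+ 2 + c * d + d ^+ 2 by nia.
have Q : 1 <= c ^+ 2 - c * d + d ^+ 2 by nia.
rewrite normsq_denom.
move: P Q; rewrite -!(ler_int R) !rmorphD rmorphN /= !rmorphXn /=.
move: (c%:~R ^+ 2 : R) (d%:~R ^+ 2 : R) ((c * d)%:~R : R) x1 x2.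
move: (complex.Re z) (normsq z) => x n cc dd cd x1 x2 P Q.
nra.
Qed.

(** The cocycle relation: the first factor is the denominator of the inverse of [g] at
    [moebius g z]. *)
Lemma moebius_denom g z : in_SL2 g -> H z ->
  ((- g 1 0)%:~R * moebius g z + (g 0 0)%:~R) *
  ((g 1 0)%:~R * z + (g 1 1)%:~R) = 1.
Proof.
move=> Ug Hz; have n := denom_neq0 Ug Hz.
have E : (g 0 0 * g 1 1 - g 0 1 * g 1 0)%:~R = 1 :> C by rewrite in_SL2_det.
by rewrite /moebius -[RHS]E; field.
Qed.

Lemma D_rigid g z : in_SL2 g -> D z -> closedD (moebius g z) -> g = 1 \/ g = -1.
Proof.
move=> Ug Dz Kgz; have Kz := D_closedD Dz; have Hz : H z by case: Kz.
have /in_SL2_det Dg := Ug.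
have E := congr1 normsq (moebius_denom Ug Hz).
have [c0|c0] := eqVneq (g 1 0) 0; last first.
  have nc0 : - g 1 0 != 0 by rewrite oppr_eq0.
  have B1 := denom_norm_bound (g 1 1) c0 Kz.
  have B2 := denom_norm_bound (g 0 0) nc0 Kgz.
  have n1 : 1 < normsq z by case/DP: Dz.
  have n2 : 1 <= normsq (moebius g z) by case: Kgz.
  have cc : 0 < (g 1 0)%:~R ^+ 2 :> R by rewrite exprn_even_gt0 //= intr_eq0.
  have cc' : 0 < (- g 1 0)%:~R ^+ 2 :> R by rewrite exprn_even_gt0 //= intr_eq0.
  move: E; rewrite normsqM [RHS]/normsq /= expr1n expr0n addr0.
  have {}B1 : 1 < normsq ((g 1 0)%:~R * z + (g 1 1)%:~R) by nra.
  have {}B2 : 1 <= normsq ((- g 1 0)%:~R * moebius g z + (g 0 0)%:~R) by nra.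
  move=> E; suff : 1 < 1 :> R by rewrite ltxx.
  by rewrite -[X in _ < X]E (lt_le_trans B1) // ler_peMl // normsq_ge0.
have ad : (g 0 0 = 1 /\ g 1 1 = 1) \/ (g 0 0 = -1 /\ g 1 1 = -1).
  move: Dg; rewrite c0 mulr0 subr0 => Dg.
  have /intUnitRing.unitzPl := Dg.
  by rewrite qualifE => /orP[] /eqP d1; move: Dg; rewrite d1; [left|right]; lia.
(* With lower left entry 0 the map is an integer translation. It moves a point of the open strip of
   width 1 into the closed strip, so the shift is 0. *)
have Egz : moebius g z = z + (g 0 0 * g 0 1)%:~R.
  by rewrite /moebius c0; case: ad => -[-> ->]; field.
have b0 : g 0 1 = 0.
  have : `|g 0 0 * g 0 1| < 1.
    rewrite -(ltr_int R) intr_norm.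
    case/DP: Dz => _ _ x1 x2; case: Kgz => _ _; rewrite Egz.
    move: (g 0 0 * g 0 1) => k; rewrite -(rmorph_int (real_complex R)) raddfD /=.
    by move=> x3 x4; rewrite ltr_norml; apply/andP; split; lra.
  by case: ad => -[-> _]; lia.
case: ad => -[a1 d1]; [left|right]; rewrite [g]matrix2_eta a1 b0 c0 d1 matrix2_1 //.
by rewrite opp_matrix2.
Qed.

(** * Continuity, and the closure of [D] *)

Local Notation near_pt z := (nbhs ((z : C) : R[i]^o)).

Lemma Re_continuous z : complex.Re w @[w --> near_pt z] --> complex.Re z.
Proof.
apply/cvgrPdist_lt => e e0.
near=> w; rewrite -raddfB -ltcR (le_lt_trans (normc_ge_Re _)) //.
near: w.
have : (fun w : R[i]^o => w) @ nbhs (z : R[i]^o) --> (z : R[i]^o) by exact: cvg_id.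
by move/cvgrPdist_lt; apply; rewrite ltcR.
Unshelve. all: by end_near. Qed.

Lemma Im_continuous z : complex.Im w @[w --> near_pt z] --> complex.Im z.
Proof.
apply/cvgrPdist_lt => e e0.
near=> w; rewrite -raddfB -ltcR; apply: (@le_lt_trans _ _ `|z - w|).
  rewrite normE lecR -sqrtr_sqr ler_wsqrtr // lerDr sqr_ge0 //.
near: w.
have : (fun w : R[i]^o => w) @ nbhs (z : R[i]^o) --> (z : R[i]^o) by exact: cvg_id.
by move/cvgrPdist_lt; apply; rewrite ltcR.
Unshelve. all: by end_near. Qed.

Lemma normsq_continuous z : normsq w @[w --> near_pt z] --> normsq z.
Proof.
rewrite /normsq; apply: cvgD; apply: cvgM;
  by [exact: Re_continuous|exact: Im_continuous].
Qed.

Lemma near_H z : H z -> \forall w \near near_pt z, H w.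
Proof. by move=> Hz; apply: (cvgr_gt _ (@Im_continuous z)). Qed.

Lemma moebius_continuous g z : in_SL2 g -> H z ->
  moebius g w @[w --> near_pt z] --> (moebius g z : R[i]^o).
Proof.
move=> Ug Hz; rewrite /moebius.
have I : (fun w : R[i]^o => w) @ nbhs (z : R[i]^o) --> (z : R[i]^o) by exact: cvg_id.
have L (a b : R[i]) : a * w + b @[w --> near_pt z] --> (a * z + b : R[i]^o).
  apply: (@cvgD _ R[i]^o _ _ _ (fun w => a * w) (fun=> b)); last exact: cvg_cst.
  by apply: (@cvgM R[i] _ _ _ (fun=> a) id); [exact: cvg_cst|exact: I].
apply: (@cvgM R[i] _ _ _ (fun w => _ * w + _) (fun w => (_ * w + _)^-1)).
  exact: L.
by apply: (@cvgV R[i] _ _ _ (fun w => _ * w + _)); [exact: denom_neq0|exact: L].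
Qed.

Lemma closureD : closureH (@D R) = closedD.
Proof.
rewrite eqEsubset; split=> z.
  move=> [Hz clz]; split=> //; rewrite leNgt; apply/negP => lt.
  - have [w [/DP[_ w1 _ _] w2]] := clz _ (cvgr_lt _ (@normsq_continuous z) _ lt).
    by have := lt_trans w1 w2; rewrite ltxx.
  - have [w [/DP[_ _ w1 _] w2]] := clz _ (cvgr_lt _ (@Re_continuous z) _ lt).
    by have := lt_trans w1 w2; rewrite ltxx.
  - have [w [/DP[_ _ _ w1] w2]] := clz _ (cvgr_gt _ (@Re_continuous z) _ lt).
    by have := lt_trans w1 w2; rewrite ltxx.
case: z => x y; rewrite /closedD /normsq /= => -[y0 n1 x1 x2]; split=> // B.
(* The radius of the ball is a complex number; being positive, it is real. *)
move=> /nbhs_ballP[[e e']]; rewrite /= ltcE /= => /andP[/eqP -> e0] sB.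
(* The point of [D] close to [z] is [((1 - t) x, y + t)]: shrinking [x] leaves the vertical edges,
   and [normsq] grows by [t (2 y - 2 x^2) + t^2 (x^2 + 1)], positive because [x^2 <= 1/4] and
   [y > 1/2]. The squared distance [t^2 (x^2 + 1)] stays below [e^2]. *)
set t := Num.min (e / 2) (1 / 2).
have te : t <= e / 2 by rewrite ge_min lexx.
have t2 : t <= 1 / 2 by rewrite ge_min lexx orbT.
have t0 : 0 < t by rewrite lt_min; apply/andP; split; lra.
clearbody t.
have xx : x ^+ 2 <= 1 / 4 by nra.
have y2 : 1 / 2 < y by nra.
have p1 : 0 < t * (2 * y - 2 * x ^+ 2) by apply: mulr_gt0 => //; lra.
have p2 : 0 <= t ^+ 2 * (x ^+ 2 + 1) by rewrite mulr_ge0 // ?sqr_ge0 //; nra.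
have p5 : t ^+ 2 * (x ^+ 2 + 1) <= t ^+ 2 * 2 by apply: ler_wpM2l; [exact: sqr_ge0|lra].
have p6 : t ^+ 2 <= e ^+ 2 / 4 by nra.
have p7 : 0 < e ^+ 2 by exact: exprn_gt0.
have p3 : 0 <= (1 - t) * (x + 1 / 2) by apply: mulr_ge0; lra.
have p4 : 0 <= (1 - t) * (1 / 2 - x) by apply: mulr_ge0; lra.
exists (((1 - t) * x) +i* (y + t))%C; split.
  by apply/DP; rewrite /normsq /=; split; nra.
apply: sB; rewrite /ball /= normE ltcR.
rewrite -[X in _ < X]ger0_norm ?ltW // -sqrtr_sqr ltr_sqrt //.
by rewrite /normsq /=; lra.
Qed.

(** The action is open, because the inverse map, that of [adj2 g], is continuous. *)
Lemma near_moebius g w (P : set C) : in_SL2 g -> H w ->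
  (\forall v \near near_pt w, P (moebius g v)) ->
  \forall z \near near_pt (moebius g w), P z.
Proof.
move=> Ug Hw nP; have Hgw := moebius_H Ug Hw.
have := @moebius_continuous (adj2 g) (moebius g w) (in_SL2_adj Ug) Hgw.
rewrite moebiusK // => /(_ _ nP) nP'.
near=> z.
have Hz : H z by near: z; exact: near_H.
rewrite -(moebiusVK Ug Hz); near: z; exact: nP'.
Unshelve. all: by end_near. Qed.

(** * Edges of the closed tile *)

Lemma side_SL2 e s : side e s -> in_SL2 s.
Proof. by case; [exact: in_SL2_T|exact: in_SL2_TV|exact: in_SL2_S]. Qed.

Lemma edgeLP z : edgeL z <->
  [/\ 0 < complex.Im z, 1 <= normsq z & complex.Re z = 1 / 2].
Proof.
by rewrite /edgeL /= /upper_half_plane /= le1_norm;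
  split=> [[? []]|[]]; split.
Qed.

Lemma edgeRP z : edgeR z <->
  [/\ 0 < complex.Im z, 1 <= normsq z & complex.Re z = - (1 / 2)].
Proof.
by rewrite /edgeR /= /upper_half_plane /= le1_norm;
  split=> [[? []]|[]]; split.
Qed.

Lemma edgeBP z : edgeB z <->
  [/\ 0 < complex.Im z, normsq z = 1, - (1 / 2) <= complex.Re z
    & complex.Re z <= 1 / 2].
Proof.
rewrite /edgeB /= /upper_half_plane /= ler_norml.
split=> [[y0 [/eq1_norm n1 /andP[]]]|[y0 n1 x1 x2]]; split=> //; split=> //.
  exact/eq1_norm.
by rewrite x1.
Qed.

Lemma side_closedD e s w : side e s -> e w -> closedD w.
Proof.
by case=> [/edgeLP|/edgeRP|/edgeBP] [? n1 x1]; rewrite /closedD /= ?n1 ?x1;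
  split; rewrite ?lexx //; lra.
Qed.

Lemma normsqV z : normsq z^-1 = (normsq z)^-1.
Proof.
have [->|z0] := eqVneq z 0.
  by rewrite invr0 /normsq /= expr0n addr0 invr0.
apply/esym/mulr1_eq; rewrite -normsqM divff //.
by rewrite /normsq /= expr1n expr0n addr0.
Qed.

Lemma normsqN z : normsq (- z) = normsq z.
Proof. by case: z => x y; rewrite /normsq /= !sqrrN. Qed.

(** The line [Re z = -1/2] separates the two tiles; in this strip only the two unit circles bound
    their union. *)
Lemma closedD_or_translate z :
  0 < complex.Im z -> - (3 / 2) < complex.Re z < 1 / 2 ->
  1 <= normsq z -> 1 <= normsq (z + 1) -> closedD z \/ closedD (moebius matT z).
Proof.
case: z => x y; rewrite moebius_T /closedD /normsq /= addr0.
move=> y0 /andP[x1 x2] n1 n2; case: (leP (- (1 / 2)) x) => x3; [left|right].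
  by split=> //; lra.
by split=> //; lra.
Qed.

(** [matT] carries the edge [R] onto [L], [matTV] carries [L] onto [R], and [matS] preserves [B]. So
    an edge also belongs to the tile on its other side. *)
Lemma side_preimage e s w : side e s -> e w ->
  exists2 u, closedD u & w = moebius s u.
Proof.
have Hnz (z : C) : 0 < complex.Im z -> z != 0.
  by move=> z0; apply: contraTneq z0 => ->; rewrite /= ltxx.
case=> [/edgeLP|/edgeRP|/edgeBP] E.
- exists (w - 1); last by rewrite moebius_T subrK.
  case: w E => x y; rewrite /closedD /normsq /= subr0 => -[y0 n1 Ex]; subst x.
  by split=> //; lra.
- exists (w + 1); last by rewrite moebius_TV addrK.
  case: w E => x y; rewrite /closedD /normsq /= addr0 => -[y0 n1 Ex]; subst x.
  by split=> //; lra.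
- exists (- w^-1); last by rewrite moebius_S invrN opprK invrK.
  case: w E => x y; rewrite /closedD /= -/(normsq (x +i* y)%C) => -[y0 n1 x1 x2].
  have nE : x ^+ 2 + y ^+ 2 = 1 by exact: n1.
  split; rewrite ?normsqN ?normsqV ?n1 ?invr1 //= ?nE ?divr1 ?opprK; lra.
Qed.

(** * The fundamental domain as a closed set, and its boundary *)

Section Domain.
Variable N : nat.
Local Notation F := (@fundamental_domain R N).

Lemma Theta_SL2 g : Theta N g -> in_SL2 g.
Proof.
by move=> /ThetaP[[i _ ->]|[j [m [_ _ _ ->]]]]; apply: in_SL2_matrix2; ring.
Qed.

Lemma in_SL2N g : in_SL2 g -> in_SL2 (- g).
Proof. by rewrite /in_SL2 /adj2 => <-; rewrite !mxE -opp_matrix2 mulrNN. Qed.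

Lemma tile_SL2 g : tile N g -> in_SL2 g.
Proof. by case=> /Theta_SL2 // /in_SL2N; rewrite opprK. Qed.

Lemma tile_domain g w : tile N g -> closedD w -> F (moebius g w).
Proof.
move=> tg Kw; case: tg => Tg; first by exists g => //; exists w; rewrite ?closureD.
by exists (- g) => //; exists w; rewrite ?closureD // moebiusN.
Qed.

Lemma domain_tile z : F z ->
  exists g w, [/\ Theta N g, closedD w & z = moebius g w].
Proof. by move=> [g Tg [w]]; rewrite closureD => Kw <-; exists g, w. Qed.

Lemma domain_H z : F z -> H z.
Proof.
by move=> /domain_tile[g [w [/Theta_SL2 Ug [w0 _ _ _] ->]]]; exact: moebius_H.
Qed.

Lemma Theta_finite : finite_set (Theta N).
Proof.
have Afin : finite_set (A N).
  apply: (@sub_finite_set _ _ ((fun k : nat => k%:Z - (N1 N)%:Z) @` `I_(N1 N + N2 N).+1)).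
    move=> i /A_bounds[i1 i2]; exists (absz (i + (N1 N)%:Z)) => /=; lia.
  exact/finite_image/finite_II.
apply: (@sub_finite_set _ _ ((level1 @` A N) `|`
   \bigcup_(j in A N) ((fun m : nat => level2 j m%:Z) @` `I_(M N j).+1))).
  move=> g /ThetaP[[i Ai ->]|[j [m [Aj gj mM ->]]]]; [left|right].
    by exists i.
  by exists j => //; exists m.
rewrite finite_setU; split; first exact: finite_image.
by apply: bigcup_finite => // j _; apply/finite_image/finite_II.
Qed.

Lemma near_not_closedD z : H z -> ~ closedD z ->
  \forall w \near near_pt z, ~ closedD w.
Proof.
rewrite /closedD /= => Hz nK.
have [n1|n1] := ltP (normsq z) 1.
  near=> w => -[_ w1 _ _]; suff : normsq w < 1 by rewrite ltNge w1.
  by near: w; exact: (cvgr_lt _ (@normsq_continuous z)).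
have [x1|x1] := ltP (complex.Re z) (- (1 / 2)).
  near=> w => -[_ _ w1 _]; suff : complex.Re w < - (1 / 2) by rewrite ltNge w1.
  by near: w; exact: (cvgr_lt _ (@Re_continuous z)).
have [x2|x2] := ltP (1 / 2) (complex.Re z).
  near=> w => -[_ _ _ w1]; suff : 1 / 2 < complex.Re w by rewrite ltNge w1.
  by near: w; exact: (cvgr_gt _ (@Re_continuous z)).
by case: nK.
Unshelve. all: by end_near. Qed.

(** The domain is closed in the half plane: it is a finite union of images of a closed set under
    homeomorphisms. *)
Lemma near_not_domain z : H z -> ~ F z -> \forall w \near near_pt z, ~ F w.
Proof.
move=> Hz nF; case/finite_fsetP: Theta_finite => T ET.
have : \forall w \near near_pt z,
    (\bigcap_(g in [set` T]) [set w | ~ closedD (moebius (adj2 g) w)]) w.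
  apply: filter_bigI => g gT; have Tg : Theta N g by rewrite ET.
  have Ug := Theta_SL2 Tg; have Ug' := in_SL2_adj Ug.
  suff nK : ~ closedD (moebius (adj2 g) z).
    exact: moebius_continuous Ug' Hz _ (near_not_closedD (moebius_H Ug' Hz) nK).
  by move=> K; apply: nF; rewrite -(moebiusVK Ug Hz); apply: tile_domain => //; left.
apply: filterS => w; rewrite -ET => nK /domain_tile[g [v [Tg Kv E]]].
have Ug := Theta_SL2 Tg; have Hv : H v by case: Kv.
by apply: (nK g Tg); rewrite E moebiusK.
Qed.

(** Closedness of the domain reduces its boundary to those of its points that are not interior. *)
Lemma boundaryP z : boundaryH F z <->
  F z /\ ~ \forall w \near near_pt z, F w.
Proof.
split.
  move=> [[Hz c1] [_ c2]]; split.
    apply: contrapT => /(near_not_domain Hz) nF.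
    by have [w [Fw]] := c1 _ nF.
  by move=> nF; have [w [[_ nFw]]] := c2 _ nF.
move=> [Fz nF]; have Hz := domain_H Fz; split; split=> //.
  exact: subset_closure.
move=> B nB; apply: contrapT => nw; apply: nF.
near=> w; apply: contrapT => nFw; apply: nw; exists w; split; last by near: w.
by split=> //; near: w; exact: near_H.
Unshelve. all: by end_near. Qed.

(** * Neighbourhoods covered by tiles *)

(** Membership in the domain seen in the coordinates of the tile [g]: for [v] in the half plane,
    [moebius g v] lies in the tile of [g * h]. All local checks then take place near the standard
    tile. *)
Definition covered_at g v : Prop := exists h,
  [/\ tile N (g * h), in_SL2 h & closedD (moebius (adj2 h) v)].

Definition covered g w : Prop := \forall v \near near_pt w, covered_at g v.

Lemma covered_at_self g v : tile N g -> closedD v -> covered_at g v.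
Proof.
move=> tg Kv; exists 1; rewrite mulr1 adj2_1 moebius1; split=> //.
exact: in_SL2_1.
Qed.

(** Change of coordinates from the tile [g] to its neighbour [g * s]. *)
Lemma covered_at_step s g v : in_SL2 s -> H v ->
  covered_at (g * s) (moebius (adj2 s) v) -> covered_at g v.
Proof.
move=> Us Hv [h [tgh Uh K]]; exists (s * h); split; first by rewrite mulrA.
  exact: in_SL2M.
by rewrite adj2M moebiusM //; exact: in_SL2_adj.
Qed.

Lemma covered_near g w : tile N g -> H w -> covered g w ->
  \forall z \near near_pt (moebius g w), F z.
Proof.
move=> tg Hw cov; have Ug := tile_SL2 tg; apply: near_moebius => //.
near=> v.
have [h [tgh Uh K]] : covered_at g v by near: v; exact: cov.
have Hv : H v by near: v; exact: near_H.
rewrite -(moebiusVK Uh Hv) -moebiusM //; first exact: tile_domain.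
by apply: moebius_H => //; exact: in_SL2_adj.
Unshelve. all: by end_near. Qed.

Lemma boundary_of_side g e s : Theta N g -> side e s -> ~ tile N (g * s) ->
  moebius g @` e `<=` boundaryH F.
Proof.
move=> Tg se nt _ [w ew <-]; have Ug := Theta_SL2 Tg; have Us := side_SL2 se.
have Kw := side_closedD se ew; apply/boundaryP; split.
  by apply: tile_domain => //; left.
have [u Ku ->] := side_preimage se ew.
have Hu : H u by case: Ku.
have Ugs := in_SL2M Ug Us.
rewrite -moebiusM // => nF.
have := moebius_continuous Ugs Hu nF.
(* As [u] is a limit of points of the open [D], some [d] in [D] is sent by [g * s] into the tile of
   some [h] in [Theta]. Rigidity then forces [g * s] to be [h] or [- h]. *)
have clu : closureH (@D R) u by rewrite closureD.
case: clu => _ clu /clu[d [Dd /domain_tile[h [k [Th Kk E]]]]].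
have Hd : H d by case: Dd.
have Uh := Theta_SL2 Th; have Uh' := in_SL2_adj Uh.
have Hk : H k by case: Kk.
have Kd : closedD (moebius (adj2 h * (g * s)) d) by rewrite moebiusM // E moebiusK.
have := D_rigid (in_SL2M Uh' Ugs) Dd Kd.
case=> /(congr1 (GRing.mul h)); rewrite mulrA Uh mul1r ?mulrN mulr1 => gs; apply: nt.
  by left; rewrite gs.
by right; rewrite gs opprK.
Qed.

Lemma covered_interior g w : tile N g -> D w -> covered g w.
Proof.
move=> tg /DP[w0 n1 x1 x2]; near=> v.
apply: covered_at_self => //; apply: D_closedD.
apply/DP; split; near: v.
- exact: near_H.
- exact: (cvgr_gt _ (@normsq_continuous w)).
- exact: (cvgr_gt _ (@Re_continuous w)).
- exact: (cvgr_lt _ (@Re_continuous w)).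
Unshelve. all: by end_near. Qed.

(** The line [Re v = 1/2] shares out the points near [w] between the two tiles. On that line [w] and
    [w - 1] have the same modulus, so both tiles stay away from their circular edge. *)
Lemma covered_L g w : tile N g -> tile N (g * matT) ->
  0 < complex.Im w -> 1 < normsq w -> complex.Re w = 1 / 2 -> covered g w.
Proof.
move=> tg tgT w0 n1 x1.
have n1' : 1 < normsq (moebius matTV w).
  rewrite moebius_TV; case: w {w0} n1 x1 => x y; rewrite /normsq /= subr0.
  by move=> n1 Ex; subst x; lra.
near=> v.
have v0 : 0 < complex.Im v by near: v; exact: near_H.
have vx1 : - (1 / 2) < complex.Re v.
  by near: v; apply: (cvgr_gt _ (@Re_continuous w)); rewrite x1; lra.
have vx2 : complex.Re v < 3 / 2.
  by near: v; apply: (cvgr_lt _ (@Re_continuous w)); rewrite x1; lra.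
have [x2|x2] := leP (complex.Re v) (1 / 2).
  apply: covered_at_self => //; split=> //; apply: ltW => //.
  by near: v; exact: (cvgr_gt _ (@normsq_continuous w)).
apply: (covered_at_step in_SL2_T) => //; apply: covered_at_self => //.
rewrite adj2_T; split.
- by apply: moebius_H => //; exact: in_SL2_TV.
- apply: ltW; near: v.
  exact: moebius_continuous in_SL2_TV w0 _ (cvgr_gt _ (@normsq_continuous _) _ n1').
- by rewrite moebius_TV raddfB /=; lra.
- by rewrite moebius_TV raddfB /=; lra.
Unshelve. all: by end_near. Qed.

Lemma covered_R g w : tile N g -> tile N (g * matTV) ->
  0 < complex.Im w -> 1 < normsq w -> complex.Re w = - (1 / 2) -> covered g w.
Proof.
move=> tg tgT w0 n1 x1.
have n1' : 1 < normsq (moebius matT w).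
  rewrite moebius_T; case: w {w0} n1 x1 => x y; rewrite /normsq /= addr0.
  by move=> n1 Ex; subst x; lra.
near=> v.
have v0 : 0 < complex.Im v by near: v; exact: near_H.
have vx1 : - (3 / 2) < complex.Re v.
  by near: v; apply: (cvgr_gt _ (@Re_continuous w)); rewrite x1; lra.
have vx2 : complex.Re v < 1 / 2.
  by near: v; apply: (cvgr_lt _ (@Re_continuous w)); rewrite x1; lra.
have [x2|x2] := leP (- (1 / 2)) (complex.Re v).
  apply: covered_at_self => //; split=> //; apply: ltW => //.
  by near: v; exact: (cvgr_gt _ (@normsq_continuous w)).
apply: (covered_at_step in_SL2_TV) => //; apply: covered_at_self => //.
rewrite adj2_TV; split.
- by apply: moebius_H => //; exact: in_SL2_T.
- apply: ltW; near: v.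
  exact: moebius_continuous in_SL2_T w0 _ (cvgr_gt _ (@normsq_continuous _) _ n1').
- by rewrite moebius_T raddfD /=; lra.
- by rewrite moebius_T raddfD /=; lra.
Unshelve. all: by end_near. Qed.

(** The unit circle shares out the points near [w]: [matS] inverts the modulus, and on the circle it
    negates the real part, so the strict bounds on the real part persist nearby. *)
Lemma covered_B g w : tile N g -> tile N (g * matS) ->
  0 < complex.Im w -> normsq w = 1 ->
  - (1 / 2) < complex.Re w -> complex.Re w < 1 / 2 -> covered g w.
Proof.
move=> tg tgS w0 n1 x1 x2.
have Rw : complex.Re (moebius matS w) = - complex.Re w.
  rewrite moebius_S; case: w {w0 x1 x2} n1 => x y; rewrite /normsq /= => ->.
  by rewrite divr1.
near=> v.
have v0 : 0 < complex.Im v by near: v; exact: near_H.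
have [n2|n2] := leP 1 (normsq v).
  apply: covered_at_self => //; split=> //; apply: ltW; near: v.
    exact: (cvgr_gt _ (@Re_continuous w)).
  exact: (cvgr_lt _ (@Re_continuous w)).
apply: (covered_at_step in_SL2_S) => //; apply: covered_at_self => //.
rewrite adj2_S moebiusN; split.
- by apply: moebius_H => //; exact: in_SL2_S.
- rewrite moebius_S normsqN normsqV invf_ge1 ?ltW //.
  by rewrite /normsq ltr_wpDl ?sqr_ge0 ?exprn_gt0.
- apply: ltW; near: v.
  have L : - (1 / 2) < complex.Re (moebius matS w) by rewrite Rw; lra.
  exact: moebius_continuous in_SL2_S w0 _ (cvgr_gt _ (@Re_continuous _) _ L).
- apply: ltW; near: v.
  have L : complex.Re (moebius matS w) < 1 / 2 by rewrite Rw; lra.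
  exact: moebius_continuous in_SL2_S w0 _ (cvgr_lt _ (@Re_continuous _) _ L).
Unshelve. all: by end_near. Qed.

Lemma covered_at_corner g v : tile N g -> tile N (g * matTV) ->
  0 < complex.Im v -> - (3 / 2) < complex.Re v < 1 / 2 ->
  1 <= normsq v -> 1 <= normsq (v + 1) -> covered_at g v.
Proof.
move=> tg tgT v0 x12 n1 n2.
have [K|K] := closedD_or_translate v0 x12 n1 n2; first exact: covered_at_self.
apply: (covered_at_step in_SL2_TV) => //; rewrite adj2_TV; exact: covered_at_self.
Qed.

(* [X] has order 3 and fixes [w = rho = exp (2 i pi / 3)].  Replacing [v] by
   [X v] permutes [1], [|v|], [|v + 1|] up to a common factor, and near [rho]
   the points where [1] is the least of the three form the union of the tiles
   of [1] and [T^-1]. *)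
Lemma covered_rho g w : let X := matS * matT in
  {in [:: g; g * X; g * (X * X)], forall h, tile N h /\ tile N (h * matTV)} ->
  0 < complex.Im w -> normsq w = 1 -> complex.Re w = - (1 / 2) -> covered g w.
Proof.
move=> X tiles w0 n1 x1.
have XE : X = matrix2 0 (-1) 1 1 by rewrite /X mul_matrix2.
have XXE : X * X = matrix2 (-1) (-1) 1 0 by rewrite XE mul_matrix2.
have UX : in_SL2 X by rewrite XE; exact: in_SL2_matrix2.
have UXX : in_SL2 (X * X) by exact: in_SL2M.
have adjX : adj2 X = - (X * X) by rewrite XXE XE opp_matrix2 /adj2 !mxE.
have adjXX : adj2 (X * X) = - X by rewrite XXE XE opp_matrix2 /adj2 !mxE.
have MX v : moebius X v = - (v + 1)^-1.
  by rewrite /moebius XE !mxE /= mul0r add0r mul1r mulN1r.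
have MXX v : moebius (X * X) v = - (v + 1) / v.
  by rewrite /moebius XXE !mxE /= mul1r addr0 mulN1r opprD.
have nz (v : C) : 0 < complex.Im v -> v != 0 /\ v + 1 != 0.
  move=> v0; split; first by apply: contraTneq v0 => ->; rewrite /= ltxx.
  by apply: contraTneq v0 => /(canRL (addrK _)) ->; rewrite /= add0r oppr0 ltxx.
have Xw : moebius X w = w.
  have [_ nz1] := nz _ w0.
  rewrite MX; apply: (mulIf nz1); rewrite mulNr mulVf //.
  case: w w0 n1 x1 {nz1} => x y /= w0; rewrite /normsq /= => n1 Ex; subst x.
  by apply/eqP; rewrite eq_complex /=; apply/andP; split; apply/eqP; lra.
have XXw : moebius (X * X) w = w by rewrite moebiusM // !Xw.
pose good (v : C) := 0 < complex.Im v /\ - (3 / 2) < complex.Re v < 1 / 2.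
have ng : \forall v \near near_pt w, good v.
  near=> v; split; first by near: v; exact: near_H.
  apply/andP; split; near: v.
    by apply: (cvgr_gt _ (@Re_continuous w)); rewrite x1; lra.
  by apply: (cvgr_lt _ (@Re_continuous w)); rewrite x1; lra.
have ngX : \forall v \near near_pt w, good (moebius X v).
  by apply: (moebius_continuous UX w0); rewrite Xw.
have ngXX : \forall v \near near_pt w, good (moebius (X * X) v).
  by apply: (moebius_continuous UXX w0); rewrite XXw.
near=> v.
have [v0 v1] : good v by near: v.
have [X0 X1] : good (moebius X v) by near: v.
have [XX0 XX1] : good (moebius (X * X) v) by near: v.
have [nzv nzv1] := nz _ v0.
have a0 := normsq_gt0 nzv; have b0 := normsq_gt0 nzv1.
have NX1 : moebius X v + 1 = v / (v + 1) by rewrite MX; field.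
have NXX1 : moebius (X * X) v + 1 = - v^-1 by rewrite MXX; field.
have [t1 t1'] := tiles g (mem_head _ _).
have [t2 t2'] : tile N (g * X) /\ tile N (g * X * matTV).
  by apply: tiles; rewrite !inE eqxx ?orbT.
have [t3 t3'] : tile N (g * (X * X)) /\ tile N (g * (X * X) * matTV).
  by apply: tiles; rewrite !inE eqxx ?orbT.
have [ba|ab] := leP (normsq (v + 1)) (normsq v).
  have [b1|b1] := leP 1 (normsq (v + 1)).
    by apply: covered_at_corner => //; exact: le_trans ba.
  apply: (covered_at_step UXX) => //; rewrite adjXX moebiusN.
  apply: covered_at_corner => //.
    by rewrite MX normsqN normsqV invf_ge1 // ltW.
  by rewrite NX1 normsqM normsqV ler_pdivlMr // mul1r.
have [a1|a1] := leP 1 (normsq v).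
  by apply: covered_at_corner => //; exact: le_trans a1 (ltW ab).
apply: (covered_at_step UX) => //; rewrite adjX moebiusN.
apply: covered_at_corner => //.
  by rewrite MXX normsqM normsqN normsqV ler_pdivlMr // mul1r ltW.
by rewrite NXX1 normsqN normsqV invf_ge1 // ltW.
Unshelve. all: by end_near. Qed.

(** * Boundary points and edges contained in the boundary *)

Lemma rho_S w : 0 < complex.Im w -> normsq w = 1 -> complex.Re w = - (1 / 2) ->
  moebius matS w = w + 1 /\ moebius matS (w + 1) = w.
Proof.
case: w => x y /= y0; rewrite /normsq /= => n1 Ex; subst x.
rewrite !moebius_S; split; apply/eqP; rewrite eq_complex /=.
  by rewrite n1 !divr1; apply/andP; split; apply/eqP; lra.
have -> : (- (1 / 2) + 1) ^+ 2 + (y + 0) ^+ 2 = 1 by lra.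
by rewrite !divr1; apply/andP; split; apply/eqP; lra.
Qed.

Lemma boundary_side z : boundaryH F z ->
  exists g e s, [/\ Theta N g, side e s, ~ tile N (g * s) & (moebius g @` e) z].
Proof.
move=> /boundaryP[Fz nF]; apply: contrapT => nex.
(* If no edge with a missing neighbour passes through [z], every edge of a tile that contains [z]
   can be crossed into another tile. *)
have cross h e s v : tile N h -> side e s -> e v -> moebius h v = z -> tile N (h * s).
  move=> th se ev Ez; apply: contrapT => nt; apply: nex.
  case: th => Th; first by exists h, e, s; split=> //; exists v.
  exists (- h), e, s; split=> //; last by exists v; rewrite ?moebiusN.
  by rewrite mulNr tileN.
have [g [w [Tg Kw Ez]]] := domain_tile Fz.
have tg : tile N g by left.
have {nF}nF h v : tile N h -> H v -> moebius h v = z -> ~ covered h v.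
  by move=> th Hv Ev /(covered_near th Hv); rewrite Ev.
have vertex h v : tile N h -> 0 < complex.Im v -> normsq v = 1 ->
    complex.Re v = - (1 / 2) -> moebius h v = z -> False.
  move=> th v0 n1 x1 Ehv; apply: (nF h v) => //.
  have [Sv Sv1] := rho_S v0 n1 x1.
  have v1 : 0 < complex.Im (v + 1) by rewrite raddfD /= addr0.
  (* Crossing [B] exchanges the corners [v] and [v + 1], and crossing [L] then brings the left
     corner back to [z]; crossing [R] instead gives the tile of [k * matTV]. Three rounds reach all
     six tiles at the vertex. *)
  have step k : tile N k -> moebius k v = z ->
      [/\ tile N (k * matTV), tile N (k * (matS * matT))
        & moebius (k * (matS * matT)) v = z].
    move=> tk Ek; have Uk := tile_SL2 tk.
    have tS : tile N (k * matS).
      by apply: (cross k (@edgeB R) matS v) => //; [exact: side_B|apply/edgeBP; split; lra].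
    have ES : moebius (k * matS) (v + 1) = z.
      by rewrite moebiusM ?Sv1 //; exact: in_SL2_S.
    have tST : tile N (k * matS * matT).
      apply: (cross _ (@edgeL R) matT (v + 1)) => //; first exact: side_L.
      apply/edgeLP; split=> //; last by rewrite raddfD /=; lra.
      by rewrite -Sv moebius_S normsqN normsqV n1 invr1.
    rewrite mulrA; split=> //.
      by apply: (cross k (@edgeR R) matTV v) => //; [exact: side_R|apply/edgeRP; split; lra].
    by rewrite moebiusM ?moebius_T //; [exact: tile_SL2|exact: in_SL2_T].
  have [t1 t2 E2] := step _ th Ehv.
  have [t3 t4 E4] := step _ t2 E2.
  have [t5 _ _] := step _ t4 E4.
  apply: covered_rho => // k; rewrite !inE.
  by case/or3P => /eqP ->; rewrite ?[h * (_ * _ * _)]mulrA.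
have [w0 n1 x1 x2] := Kw.
have {}Ez := esym Ez.
have [n1'|n1'] := eqVneq (normsq w) 1.
  have [E1|x1'] := eqVneq (complex.Re w) (- (1 / 2)); first exact: (vertex g w).
  (* The right corner of [g] is the left corner of the neighbour [g * matT]. *)
  have [E2|x2'] := eqVneq (complex.Re w) (1 / 2).
    have tgT : tile N (g * matT).
      by apply: (cross g (@edgeL R) matT w) => //; [exact: side_L|apply/edgeLP].
    have Tw : moebius matT (w - 1) = w by rewrite moebius_T subrK.
    have w1 : 0 < complex.Im (w - 1) by rewrite raddfB /= subr0.
    apply: (vertex (g * matT) (w - 1)) => //.
    - case: w n1' E2 {w0 n1 x1 x2 Kw Ez x1' tgT Tw w1} => x y.
      by rewrite /normsq /= subr0 => n1 Ex; subst x; lra.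
    - by rewrite raddfB /=; lra.
    - by rewrite moebiusM ?Tw //; [exact: Theta_SL2|exact: in_SL2_T].
  apply: (nF g w) => //; apply: covered_B => //.
  - by apply: (cross g (@edgeB R) matS w) => //; [exact: side_B|apply/edgeBP].
  - by rewrite lt_neqAle eq_sym x1' x1.
  - by rewrite lt_neqAle x2' x2.
have {n1'}n1' : 1 < normsq w by rewrite lt_neqAle eq_sym n1' n1.
have [E1|x1'] := eqVneq (complex.Re w) (- (1 / 2)).
  apply: (nF g w) => //; apply: covered_R => //.
  by apply: (cross g (@edgeR R) matTV w) => //; [exact: side_R|apply/edgeRP].
have [E2|x2'] := eqVneq (complex.Re w) (1 / 2).
  apply: (nF g w) => //; apply: covered_L => //.
  by apply: (cross g (@edgeL R) matT w) => //; [exact: side_L|apply/edgeLP].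
apply: (nF g w) => //; apply: covered_interior => //; apply/DP; split=> //.
- by rewrite lt_neqAle eq_sym x1' x1.
- by rewrite lt_neqAle x2' x2.
Qed.

(** A corner of such an edge may still be on the boundary because of other tiles, so an inner point
    is tested: [1/2 + 2i], [-1/2 + 2i] or [i], around which the two adjacent tiles fill a
    neighbourhood. *)
Lemma side_not_boundary g e s : Theta N g -> side e s -> tile N (g * s) ->
  ~ (moebius g @` e `<=` boundaryH F).
Proof.
move=> Tg se tgs sub; have tg : tile N g by left.
suff [w [ew Hw cov]] : exists w, [/\ e w, H w & covered g w].
  have /boundaryP[_] : boundaryH F (moebius g w) by apply: sub; exists w.
  by apply; exact: covered_near.
case: se tgs => tgs.
- exists (1 / 2 +i* 2)%C; split=> //; last apply: covered_L => //.
  + by apply/edgeLP; rewrite /normsq /=; split=> //; lra.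
  + by rewrite /upper_half_plane /= ltr0n.
  + by rewrite /normsq /=; lra.
- exists (- (1 / 2) +i* 2)%C; split=> //; last apply: covered_R => //.
  + by apply/edgeRP; rewrite /normsq /=; split=> //; lra.
  + by rewrite /upper_half_plane /= ltr0n.
  + by rewrite /normsq /=; lra.
- exists (0 +i* 1)%C; split=> //=; last apply: covered_B => //=.
  + by apply/edgeBP; rewrite /normsq /=; split=> //; lra.
  + by rewrite /upper_half_plane /= ltr01.
  + by rewrite /normsq /=; lra.
Qed.

End Domain.
End Moebius.

Theorem proposition1p19 (R : realType) (N : nat) (hN : (1 < N)%N) :
  boundaryH (fundamental_domain R N)
    = \bigcup_(X in [set X | listed_arc R N X]) X
  /\ boundary_edges R N = [set X | listed_arc R N X].
Proof.
split; rewrite eqEsubset; split.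
- move=> z /boundary_side[g [e [s [Tg se nt ez]]]].
  by exists (moebius g @` e) => //; apply/listed_arcP => //; exists g, e, s.
- move=> z [X /(listed_arcP _ hN)[g [e [s [Tg se -> nt]]]]].
  exact: boundary_of_side Tg se nt z.
(* An edge inside the boundary has its outer neighbour missing, since otherwise its inner points
   would be interior. *)
- move=> X [g [e [Tg He -> sub]]].
  have [s se] : exists s, side e s.
    case: He => [->|[->|->]].
    + by exists matT; exact: side_L.
    + by exists matTV; exact: side_R.
    + by exists matS; exact: side_B.
  apply/listed_arcP => //; exists g, e, s; split=> // tgs.
  exact: side_not_boundary Tg se tgs sub.
- move=> X /(listed_arcP _ hN)[g [e [s [Tg se -> nt]]]].
  exists g, e; split=> //; last exact: boundary_of_side Tg se nt.
  by case: se {nt} => //; [left|right; left|right; right].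
Qed.
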